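(* Suppose that $\Phi+\delta_{S_1}$ has bounded level sets. Let $\{x^k\}$ be a sequence generated by the penalty method (described in the context) for solving $\min\{\Phi(x):x\in S\}$. Then: (i) $\{x^k\}$ is bounded. (ii) Any accumulation point $x^*$ of $\{x^k\}$ is a feasible point of $\min\{\Phi(x):x\in S\}$, i.e. $x^*\in S$. (iii) Suppose that $\{x^k\}_{k\in\mathcal K}\to x^*$ for some subsequence $\mathcal K$ and that the constraint qualification $$-\partial^{\infty}(\Phi+\delta_{S_1})(x^* )\cap\mathcal N_{S_2}(x^* )=\{0\}$$ holds. Then $x^*$ is a KKT point of $\min\{\Phi(x):x\in S\}$, i.e. $x^*\in S$ and $0\in\mathcal N_{S_2}(x^* )+\partial(\Phi+\delta_{S_1})(x^* )$.
   Context: Standing setting. $\Phi:\mathbb{R}^n\to\mathbb{R}$ is a nonnegative continuous function. $A\in\mathbb{R}^{m\times n}$ has full row rank, $b\in\mathbb{R}^m$, $\sigma\ge 0$, $B\in\mathbb{R}^{\ell\times n}$, $h\in\mathbb{R}^\ell$, and $D$, $d$ are a matrix and a vector of compatible sizes. $S_1=\{x\in\mathbb{R}^n: Dx\le d\}$, $S_2=\{x\in\mathbb{R}^n:\|Ax-b\|\le\sigma,\ Bx\le h\}$, $S=S_1\cap S_2$ (inequalities componentwise, $\|\cdot\|$ Euclidean), and there exists $x_0\in S$ with $\|Ax_0-b\|<\sigma$. $\delta_{S_1}$ is the indicator function ($0$ on $S_1$, $+\infty$ elsewhere); $\Phi+\delta_{S_1}$ has bounded level sets if $\{x\in S_1:\Phi(x)\le\alpha\}$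 is bounded for each $\alpha\in\mathbb{R}$. $\mathcal N_{S_2}(x)=\{y: y^T(u-x)\le 0\ \forall u\in S_2\}$ for $x\in S_2$. Subdifferentials. For a proper lower semicontinuous $f$, write $v\in\hat\partial f(x)$ if $\liminf_{z\to x, z\ne x}\frac{f(z)-f(x)-\langle v,z-x\rangle}{\|z-x\|}\ge0$. Write $x^k\stackrel{f}{\to}x$ for $x^k\to x$ and $f(x^k)\to f(x)$. The limiting subdifferential is $\partial f(x)=\{v:\exists x^k\stackrel{f}{\to}x,\ v^k\to v,\ v^k\in\hat\partial f(x^k)\}$ and the horizon subdifferential is $\partial^{\infty}f(x)=\{v:\exists x^k\stackrel{f}{\to}x,\ \lambda_kv^k\to v,\ \lambda_k>0,\ \lambda_k\to0,\ v^k\in\hat\partial f(x^k)\}$. Smoothed penalty functions. For $\lambda,\mu>0$, $h_{\lambda,\mu}(s)=\lambda\max_{0\le t\le1}\{st-\frac\mu2t^2\}$, $$f_{\lambda,\mu}(x)=h_{\lambda,\mu}(\|Ax-b\|^2-\sigma^2)+\sum_{i=1}^\ell h_{\lambda,\mu}([Bx-h]_i),\qquad F_{\lambda,\mu}(x)=f_{\lambda,\mu}(x)+\Phi(x).$$ NPG (nonmonotone proximal gradient) method for $\min_x F(x)=f(x)+P(x)$, here applied with $f=f_{\lambda,\mu}$ and $P=\Phi+\delta_{S_1}$, from an initial point $y^0\in S_1$: choose $L_{\max}\ge L_{\min}>0$, $\tau>1$, $c>0$ and an integer $M\ge0$. For $j=0,1,2,\dots$: choose $L_j^0\in[L_{\min},L_{\max}]$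 and set $L_j=L_j^0$; (a) compute $u\in\mathrm{Arg\,min}_x\{\langle\nabla f(y^j),x-y^j\rangle+\frac{L_j}2\|x-y^j\|^2+P(x)\}$; (b) if $F(u)\le\max_{\max\{j-M,0\}\le i\le j}F(y^i)-\frac c2\|u-y^j\|^2$, set $y^{j+1}=u$ and proceed to $j+1$; otherwise replace $L_j$ by $\tau L_j$ and return to (a). Penalty method. Let $x^{\rm feas}\in S$ be arbitrary. Choose $x^0\in S_1$, $\lambda_0>0$, $\mu_0>0$, $\epsilon_0>0$, $\rho>1$, $\theta\in(0,1)$ arbitrarily; set $x^{0,0}=x^0$. For $k=0,1,2,\dots$: 1) If $F_{\lambda_k,\mu_k}(x^{k,0})>F_{\lambda_k,\mu_k}(x^{\rm feas})$, reset $x^{k,0}=x^{\rm feas}$. Apply the NPG method with initial point $x^{k,0}$ to $\min_{x\in S_1}F_{\lambda_k,\mu_k}(x)$ to find an iterate $x^k$ (an approximate stationary point) satisfying $\mathrm{dist}(0,\nabla f_{\lambda_k,\mu_k}(x^k)+\partial(\Phi+\delta_{S_1})(x^k))\le\epsilon_k$. 2) Set $\lambda_{k+1}=\rho\lambda_k$, $\mu_{k+1}=\theta\mu_k$, $\epsilon_{k+1}=\theta\epsilon_k$, $x^{k+1,0}=x^k$. *)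

(* Defs.v *)
From HB Require Import structures.
From mathcomp Require Import all_boot all_order all_algebra.
From mathcomp Require Import all_classical all_reals all_analysis.
Set Implicit Arguments.
Unset Strict Implicit.
Unset Printing Implicit Defensive.
Import Order.TTheory GRing.Theory Num.Theory.
Import numFieldNormedType.Exports.
Local Open Scope classical_set_scope.
Local Open Scope ring_scope.

(* The library's topology, limits and bounded sets on ['cV[R]_n] come from
   the max norm [`| x |]; they coincide with those of the Euclidean norm
   [enorm], which is the norm used in all formulas below. *)

Definition dotv (R : realType) (n : nat) (u v : 'cV[R]_n) : R :=
  \sum_(i < n) u i 0 * v i 0.

Definition enorm (R : realType) (n : nat) (u : 'cV[R]_n) : R :=
  Num.sqrt (dotv u u).

Definition lev (R : realType) (n : nat) (u v : 'cV[R]_n) : Prop :=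
  forall i, u i 0 <= v i 0.

Definition gradient (R : realType) (n : nat) (f : 'cV[R]_n -> R)
    (x : 'cV[R]_n) : 'cV[R]_n :=
  \col_i 'D_(delta_mx i 0) f x.

Definition indicator (R : realType) (T : Type) (C : set T) (x : T) : \bar R :=
  if x \in C then 0%E else +oo%E.

Definition argmin (R : realType) (T : Type) (g : T -> \bar R) : set T :=
  [set u | forall z, (g u <= g z)%E].

(* Distance to the origin; it is [+oo] when [C] is empty. *)
Definition dist0 (R : realType) (n : nat) (C : set 'cV[R]_n) : \bar R :=
  ereal_inf [set (enorm v)%:E | v in C].

(* Subdifferentials of extended-valued functions are empty outside the
   effective domain, hence the [fin_num] conditions. *)

Definition regular_subdiff (R : realType) (n : nat) (f : 'cV[R]_n -> \bar R)
    (x : 'cV[R]_n) : set 'cV[R]_n :=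
  [set v | f x \is a fin_num /\
    (0 <= limf_einf
            (fun z => (f z - f x - (dotv v (z - x))%:E)
                        * ((enorm (z - x))^-1)%:E) x^')%E].

Definition attentive_cvg (R : realType) (n : nat) (f : 'cV[R]_n -> \bar R)
    (xs : nat -> 'cV[R]_n) (x : 'cV[R]_n) : Prop :=
  (xs k @[k --> \oo] --> x) /\ (f (xs k) @[k --> \oo] --> f x).

Definition limiting_subdiff (R : realType) (n : nat) (f : 'cV[R]_n -> \bar R)
    (x : 'cV[R]_n) : set 'cV[R]_n :=
  [set v | f x \is a fin_num /\
    exists xs vs : nat -> 'cV[R]_n,
      [/\ attentive_cvg f xs x,
          vs k @[k --> \oo] --> v
        & forall k, regular_subdiff f (xs k) (vs k)]].

Definition horizon_subdiff (R : realType) (n : nat) (f : 'cV[R]_n -> \bar R)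
    (x : 'cV[R]_n) : set 'cV[R]_n :=
  [set v | f x \is a fin_num /\
    exists (xs vs : nat -> 'cV[R]_n) (ls : nat -> R),
      [/\ attentive_cvg f xs x,
          ls k *: vs k @[k --> \oo] --> v,
          forall k, 0 < ls k,
          ls k @[k --> \oo] --> (0 : R)
        & forall k, regular_subdiff f (xs k) (vs k)]].

Definition normal_cone (R : realType) (n : nat) (C : set 'cV[R]_n)
    (x : 'cV[R]_n) : set 'cV[R]_n :=
  [set y | forall u, C u -> dotv y (u - x) <= 0].

Section NPG.
Variables (R : realType) (n : nat).
Variables (f : 'cV[R]_n -> R) (P : 'cV[R]_n -> \bar R).

Let F (x : 'cV[R]_n) : \bar R := ((f x)%:E + P x)%E.

Definition npg_model (y : 'cV[R]_n) (L : R) (x : 'cV[R]_n) : \bar R :=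
  ((dotv (gradient f y) (x - y) + L / 2 * enorm (x - y) ^+ 2)%:E + P x)%E.

(* The truncated subtraction [j - M] is max{j - M, 0}. *)
Definition npg_accept (c : R) (M : nat) (y : nat -> 'cV[R]_n) (j : nat)
    (u : 'cV[R]_n) : Prop :=
  (F u <= (\big[maxe/-oo]_((j - M)%N <= i < j.+1) F (y i))
            - (c / 2 * enorm (u - y j) ^+ 2)%:E)%E.

(* [u i] is the trial point of the [i]-th pass of the inner loop, computed with
   L_j = tau ^ i * L0; the pass [r] is the first one to be accepted. *)
Definition npg_step (Lmin Lmax tau c : R) (M : nat) (y : nat -> 'cV[R]_n)
    (j : nat) : Prop :=
  exists (L0 : R) (r : nat) (u : nat -> 'cV[R]_n),
    [/\ Lmin <= L0 <= Lmax,
        forall i, (i <= r)%N -> argmin (npg_model (y j) (tau ^+ i * L0)) (u i),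
        forall i, (i < r)%N -> ~ npg_accept c M y j (u i),
        npg_accept c M y j (u r)
      & y j.+1 = u r].

(* [z] is one of the iterates produced by some run of the method from [y0];
   only the first [J] steps of the run matter. *)
Definition npg_iterate (y0 z : 'cV[R]_n) : Prop :=
  exists (Lmin Lmax tau c : R) (M : nat) (y : nat -> 'cV[R]_n) (J : nat),
    [/\ 0 < Lmin <= Lmax, 1 < tau & 0 < c] /\
    [/\ y 0%N = y0,
        forall j, (j < J)%N -> npg_step Lmin Lmax tau c M y j
      & z = y J].

End NPG.

Section Problem.
Variables (R : realType) (n m l p : nat).
Variables (Phi : 'cV[R]_n -> R).
Variables (A : 'M[R]_(m, n)) (b : 'cV[R]_m) (sigma : R).
Variables (B : 'M[R]_(l, n)) (h : 'cV[R]_l).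
Variables (D : 'M[R]_(p, n)) (d : 'cV[R]_p).

Definition S1 : set 'cV[R]_n := [set x | lev (D *m x) d].

Definition S2 : set 'cV[R]_n :=
  [set x | enorm (A *m x - b) <= sigma /\ lev (B *m x) h].

Definition feasible : set 'cV[R]_n := S1 `&` S2.

Definition Phi_S1 (x : 'cV[R]_n) : \bar R :=
  ((Phi x)%:E + indicator R S1 x)%E.

Definition bounded_level_sets : Prop :=
  forall alpha : R, bounded_set [set x | S1 x /\ Phi x <= alpha].

Definition smooth_plus (lambda mu s : R) : R :=
  lambda * sup [set s * t - mu / 2 * t ^+ 2 | t in `[0, 1]%classic].

Definition penalty (lambda mu : R) (x : 'cV[R]_n) : R :=
  smooth_plus lambda mu (enorm (A *m x - b) ^+ 2 - sigma ^+ 2)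
    + \sum_(i < l) smooth_plus lambda mu ((B *m x - h) i 0).

Definition penalized (lambda mu : R) (x : 'cV[R]_n) : R :=
  penalty lambda mu x + Phi x.

Definition approx_stationary (lambda mu eps : R) (x : 'cV[R]_n) : Prop :=
  (dist0 [set (gradient (penalty lambda mu) x + v)%R
            | v in limiting_subdiff Phi_S1 x] <= eps%:E)%E.

Definition penalty_start (lambda mu : R) (xfeas z : 'cV[R]_n) : 'cV[R]_n :=
  if penalized lambda mu xfeas < penalized lambda mu z then xfeas else z.

(* [x k] is the point found at the end of the [k]-th outer iteration; [xinit]
   is the user-chosen initial point, so that the iteration [k] is warm-started
   at [xinit] if [k = 0] and at [x k.-1] otherwise. *)
Definition penalty_method_sequence (x : nat -> 'cV[R]_n) : Prop :=
  exists (xfeas xinit : 'cV[R]_n) (lambda mu eps : nat -> R) (rho theta : R),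
    [/\ feasible xfeas, S1 xinit, 1 < rho & 0 < theta < 1] /\
    [/\ 0 < lambda 0%N, 0 < mu 0%N & 0 < eps 0%N] /\
    [/\ forall k, lambda k.+1 = rho * lambda k,
        forall k, mu k.+1 = theta * mu k
      & forall k, eps k.+1 = theta * eps k] /\
    forall k,
      npg_iterate (penalty (lambda k) (mu k)) Phi_S1
        (penalty_start (lambda k) (mu k) xfeas
           (if k is k'.+1 then x k' else xinit))
        (x k) /\
      approx_stationary (lambda k) (mu k) (eps k) (x k).

Definition constraint_qualification (x : 'cV[R]_n) : Prop :=
  [set - v | v in horizon_subdiff Phi_S1 x] `&` normal_cone S2 x = [set 0].

Definition kkt_point (x : 'cV[R]_n) : Prop :=
  feasible x /\
  [set u + v | u in normal_cone S2 x & v in limiting_subdiff Phi_S1 x] 0.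

End Problem.

(* Main.v *)
(* The smoothed penalty vanishes on the feasible set and dominates
   lambda * (s - mu / 2) for each constraint value s; as the inner method never
   exceeds its initial value, Phi (x k) <= Phi xfeas and the constraint
   violations are at most Phi xfeas / lambda_k + mu_k, which tends to 0. This
   gives (i) and (ii).
   For (iii), the gradient of the penalty at x k splits as
   t_k *: A^T (A x k - b) + w_k, where t_k >= 0 and w_k lies eventually in the
   normal cone at xstar of the polyhedron {B u <= h}. Dividing stationarity by
   1 + t_k + |w_k| makes everything bounded; along an ultrafilter the scaled data
   (a_k, a_k t_k, a_k w_k) tends to (alpha, T, W) with alpha + T + |W| = 1. If
   alpha > 0, dividing by alpha gives the KKT relation. If alpha = 0, the limit is
   a horizon subgradient, so T *: A^T (A xstar - b) + W = 0 by the constraint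
   qualification; the Slater point forces T = 0, hence W = 0, a contradiction.
   Normalising by the vector w_k rather than by its multipliers avoids any
   linear independence of the rows of B. *)

Require Import Defs.
From mathcomp Require Import all_boot all_order all_algebra.
From mathcomp Require Import all_classical all_reals all_analysis.
From mathcomp Require Import ring lra.
Set Implicit Arguments.
Unset Strict Implicit.
Unset Printing Implicit Defensive.
Import Order.TTheory GRing.Theory Num.Theory.
Import numFieldNormedType.Exports.
Local Open Scope classical_set_scope.
Local Open Scope ring_scope.

(** * Euclidean inner product and norm *)

Lemma dotvE (R : realType) n (u v : 'cV[R]_n) : dotv u v = (u^T *m v) 0 0.
Proof. by rewrite mxE; apply: eq_bigr => i _; rewrite mxE. Qed.

Lemma dotvC (R : realType) n (u v : 'cV[R]_n) : dotv u v = dotv v u.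
Proof. by apply: eq_bigr => i _; rewrite mulrC. Qed.

Lemma dotvDr (R : realType) n (u v w : 'cV[R]_n) :
  dotv u (v + w) = dotv u v + dotv u w.
Proof. by rewrite !dotvE mulmxDr mxE. Qed.

Lemma dotvZr (R : realType) n a (u v : 'cV[R]_n) :
  dotv u (a *: v) = a * dotv u v.
Proof. by rewrite !dotvE -scalemxAr mxE. Qed.

Lemma dotvDl (R : realType) n (u v w : 'cV[R]_n) :
  dotv (u + v) w = dotv u w + dotv v w.
Proof. by rewrite dotvC dotvDr !(dotvC w). Qed.

Lemma dotvZl (R : realType) n a (u v : 'cV[R]_n) :
  dotv (a *: u) v = a * dotv u v.
Proof. by rewrite dotvC dotvZr (dotvC v). Qed.

Lemma dotv_adj (R : realType) m n (M : 'M[R]_(m, n)) (u : 'cV[R]_m) v :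
  dotv (M^T *m u) v = dotv u (M *m v).
Proof. by rewrite !dotvE trmx_mul trmxK mulmxA. Qed.

Lemma dotv_delta (R : realType) n (u : 'cV[R]_n) i :
  dotv u (delta_mx i 0) = u i 0.
Proof.
rewrite /dotv (bigD1 i) //= mxE !eqxx mulr1 big1 ?addr0// => j ji.
by rewrite mxE (negPf ji) mulr0.
Qed.

Lemma dotv_ge0 (R : realType) n (u : 'cV[R]_n) : 0 <= dotv u u.
Proof. by apply: sumr_ge0 => i _; rewrite -expr2 sqr_ge0. Qed.

Lemma enorm_ge0 (R : realType) n (u : 'cV[R]_n) : 0 <= enorm u.
Proof. exact: sqrtr_ge0. Qed.

Lemma enorm_sqr (R : realType) n (u : 'cV[R]_n) : enorm u ^+ 2 = dotv u u.
Proof. by rewrite sqr_sqrtr ?dotv_ge0. Qed.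

Lemma coord_le_enorm (R : realType) n (u : 'cV[R]_n) i : `|u i 0| <= enorm u.
Proof.
rewrite -(@ler_pXn2r _ 2) ?nnegrE ?enorm_ge0// enorm_sqr real_normK ?num_real//.
rewrite /dotv (bigD1 i) //= -expr2 lerDl.
by apply: sumr_ge0 => j _; rewrite -expr2 sqr_ge0.
Qed.

(** * Entrywise limits of matrices and limits along ultrafilters *)

Lemma cvg_mxP (R : realType) m n I (F : set_system I) {FF : Filter F}
    (f : I -> 'M[R]_(m, n)) (M : 'M[R]_(m, n)) :
  (forall i j, f k i j @[k --> F] --> M i j) -> f k @[k --> F] --> M.
Proof.
move=> fM B [P PM PB].
have : \forall k \near F, forall i j, P i j (f k i j).
  apply: filter_forall => i; apply: filter_forall => j.
  exact: fM (PM i j).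
by apply: filterS => k Pk; apply: PB.
Qed.

Lemma cvg_coord (R : realType) m n I (F : set_system I) {FF : Filter F}
    (f : I -> 'M[R]_(m, n)) (M : 'M[R]_(m, n)) i j :
  f k @[k --> F] --> M -> f k i j @[k --> F] --> M i j.
Proof.
move=> fM; apply: (cvg_comp f (fun N : 'M[R]_(m, n) => N i j) fM).
exact: coord_continuous.
Qed.

Lemma cvg_sumr (R : realType) (J : Type) (r : seq J) I (F : set_system I)
    {FF : Filter F} (f : J -> I -> R) (a : J -> R) :
  (forall j, f j k @[k --> F] --> a j) ->
  \sum_(j <- r) f j k @[k --> F] --> \sum_(j <- r) a j.
Proof. by move=> fa; apply: cvg_big => //; exact: add_continuous. Qed.

Lemma cvg_mulmx (R : realType) m n q I (F : set_system I) {FF : Filter F}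
    (A : 'M[R]_(m, n)) (f : I -> 'M[R]_(n, q)) M :
  f k @[k --> F] --> M -> A *m f k @[k --> F] --> A *m M.
Proof.
move=> fM; apply: cvg_mxP => i j; rewrite mxE.
under eq_fun do rewrite mxE.
apply: cvg_sumr => s; apply: cvgMr; exact: cvg_coord.
Qed.

Lemma cvg_dotv (R : realType) n I (F : set_system I) {FF : Filter F}
    (f g : I -> 'cV[R]_n) u v :
  f k @[k --> F] --> u -> g k @[k --> F] --> v ->
  dotv (f k) (g k) @[k --> F] --> dotv u v.
Proof.
move=> fu gv; apply: cvg_sumr => s; apply: cvgM; exact: cvg_coord.
Qed.

(** Compactness supplies a cluster point; an ultrafilter contains each neighbourhood of it or the
    complement, and clustering excludes the complement. Limits along one ultrafilter stand in for
    successive extractions of subsequences. *)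
Lemma ultra_compact_cvg (T : topologicalType) I (U : set_system I)
    (f : I -> T) (K : set T) :
  UltraFilter U -> compact K -> (forall k, K (f k)) ->
  exists p : T, f k @[k --> U] --> p.
Proof.
move=> UU Kc fK.
have [p [_ clp]] : K `&` cluster (f k @[k --> U]) !=set0.
  apply: Kc; by apply: (@filterS _ U _ setT); [move=> k _; exact: fK|exact: filterT].
exists p => B pB.
have [//|UnB] := in_ultra_setVsetC (f @^-1` B) UU.
have [z [nBz /nBz]] := clp (~` B) B UnB pB.
by [].
Qed.

Lemma ultra_bounded_cvg (R : realType) I (U : set_system I)
    (f : I -> R) (C : R) :
  UltraFilter U -> (forall k, `|f k| <= C) ->
  exists p : R, f k @[k --> U] --> p.
Proof.
move=> UU fC; apply: (ultra_compact_cvg UU (@segment_compact R (- C) C)).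
by move=> k /=; rewrite in_itv /= -ler_norml.
Qed.

Lemma ultra_bounded_cvg_cV (R : realType) n I (U : set_system I)
    (f : I -> 'cV[R]_n) (C : R) :
  UltraFilter U -> (forall k i, `|f k i 0| <= C) ->
  exists p : 'cV[R]_n, f k @[k --> U] --> p.
Proof.
move=> UU fC.
have /choice [p fp] i : exists p : R, f k i 0 @[k --> U] --> p.
  exact: (ultra_bounded_cvg (C := C)).
exists (\col_i p i); apply: cvg_mxP => i j; rewrite ord1 mxE; exact: fp.
Qed.

Lemma coord_le_norm (R : realType) m n (u : 'M[R]_(m, n)) i j : `|u i j| <= `|u|.
Proof.
rewrite [leRHS]/Num.norm /= mx_normrE; apply/bigmax_geP; right => /=.
by exists (i, j).
Qed.

(** * The smoothed positive part and its derivative *)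

(* The maximiser of [s * t - mu / 2 * t ^+ 2] over [0 <= t <= 1]. *)
Definition clip (R : realType) (mu s : R) : R := Num.max 0 (Num.min 1 (s / mu)).

Lemma clip_itv (R : realType) (mu s : R) : 0 <= clip mu s <= 1.
Proof.
rewrite /clip le_max lexx /= ge_max ler01 /=.
by rewrite ge_min lexx.
Qed.

Lemma clip_le0 (R : realType) (mu s : R) : 0 < mu -> s <= 0 -> clip mu s = 0.
Proof.
move=> mu0 s0; apply/max_idPl; rewrite ge_min; apply/orP; right.
by rewrite pmulr_lle0 ?invr_gt0.
Qed.

(** First-order optimality: the first factor is the derivative of the concave objective at its
    maximiser. With [mu] factored out, [clip] is the projection of [s / mu] onto [0, 1], whence the
    case split. *)
Lemma clip_opt (R : realType) (mu s t : R) : 0 < mu -> 0 <= t <= 1 ->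
  0 <= (s - mu * clip mu s) * (clip mu s - t).
Proof.
move=> mu0 /andP[t0 t1].
have E : s = mu * (s / mu) by rewrite mulrCA divff ?mulr1// gt_eqF.
rewrite {1}E -mulrBr -mulrA pmulr_rge0 // /clip; move: (s / mu) => r.
by case: (leP 1 r) => r1; [case: (leP 0 1) => r0|case: (leP 0 r) => r0]; nra.
Qed.

Lemma clip_max (R : realType) (mu s t : R) : 0 < mu -> 0 <= t <= 1 ->
  s * t - mu / 2 * t ^+ 2 <= s * clip mu s - mu / 2 * clip mu s ^+ 2.
Proof.
move=> mu0 tI; have := clip_opt s mu0 tI; move: (clip mu s) => c opt.
have : 0 <= mu * (c - t) ^+ 2 by rewrite mulr_ge0 ?sqr_ge0 // ltW.
by rewrite !expr2; lra.
Qed.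

Lemma smooth_plusE (R : realType) (lambda mu s : R) : 0 < mu ->
  smooth_plus lambda mu s =
    lambda * (s * clip mu s - mu / 2 * clip mu s ^+ 2).
Proof.
move=> mu0; congr (_ * _).
set E := [set _ | _ in _]; set c := clip mu s.
have cI := clip_itv mu s.
have Ec : E (s * c - mu / 2 * c ^+ 2).
  by exists c => //=; rewrite in_itv.
have ubE : ubound E (s * c - mu / 2 * c ^+ 2).
  move=> y [t /=]; rewrite in_itv /= => tI <-.
  exact: clip_max.
apply/eqP; rewrite eq_le; apply/andP; split.
  by apply: ge_sup => //; exists (s * c - mu / 2 * c ^+ 2).
by apply: ub_le_sup => //; exists (s * c - mu / 2 * c ^+ 2).
Qed.

Lemma smooth_plus_ge (R : realType) (lambda mu s t : R) :
  0 < lambda -> 0 < mu -> 0 <= t <= 1 ->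
  lambda * (s * t - mu / 2 * t ^+ 2) <= smooth_plus lambda mu s.
Proof.
by move=> l0 mu0 tI; rewrite smooth_plusE // ler_pM2l // clip_max.
Qed.

Lemma smooth_plus_ge0 (R : realType) (lambda mu s : R) :
  0 < lambda -> 0 < mu -> 0 <= smooth_plus lambda mu s.
Proof.
move=> l0 mu0; have := @smooth_plus_ge R lambda mu s 0 l0 mu0.
by rewrite lexx ler01 /= expr0n /= !mulr0 subrr mulr0; apply.
Qed.

Lemma smooth_plus_le0 (R : realType) (lambda mu s : R) :
  0 < mu -> s <= 0 -> smooth_plus lambda mu s = 0.
Proof.
move=> mu0 s0; rewrite smooth_plusE // clip_le0 // expr0n /= !mulr0 subrr.
by rewrite mulr0.
Qed.

(** Let c and c' be the maximisers at s and s'. Maximality of c' makes the remainder nonnegative,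
    maximality of c bounds it by lambda * (s' - s) * (c' - c), and the sum of the two optimality
    conditions controls c' - c by (s' - s) / mu. *)
Lemma smooth_plus_taylor (R : realType) (lambda mu s s' : R) :
  0 < lambda -> 0 < mu ->
  `|smooth_plus lambda mu s' - smooth_plus lambda mu s
    - lambda * clip mu s * (s' - s)| <= lambda / mu * (s' - s) ^+ 2.
Proof.
move=> l0 mu0; rewrite !smooth_plusE //.
have cI := clip_itv mu s; have cI' := clip_itv mu s'.
have := clip_opt s' mu0 cI; have := clip_opt s mu0 cI'.
have := clip_max s' mu0 cI; have := clip_max s mu0 cI'.
move: (clip mu s) (clip mu s') {cI cI'} => c c' m1 m2 o1 o2.
set X := s' * c' - mu / 2 * c' ^+ 2 - (s * c - mu / 2 * c ^+ 2) - c * (s' - s).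
have -> : lambda * (s' * c' - mu / 2 * c' ^+ 2)
   - lambda * (s * c - mu / 2 * c ^+ 2) - lambda * c * (s' - s) = lambda * X.
  by rewrite /X; ring.
have X0 : 0 <= X by rewrite /X; lra.
have X1 : X <= (s' - s) * (c' - c) by rewrite /X; lra.
have opt : mu * (c' - c) ^+ 2 <= (s' - s) * (c' - c) by rewrite expr2; lra.
have sq := sqr_ge0 (s' - s - mu * (c' - c)).
have le : mu * X <= (s' - s) ^+ 2.
  have h1 := ler_wpM2l (ltW mu0) X1.
  have h2 := ler_wpM2l (ltW mu0) opt.
  by rewrite !expr2 in sq h2 *; lra.
rewrite ger0_norm ?mulr_ge0 ?(ltW l0)// -mulrA ler_pM2l //.
by rewrite ler_pdivlMl.
Qed.

(** * Directional derivatives and the gradient of the penalty *)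

(** Differentiability at 0 with derivative [a], strengthened to a quadratic remainder on [-1, 1]. In
    this form sums and composition with [smooth_plus] reduce to plain inequalities. *)
Definition quad_expand (R : realType) (g : R -> R) (a : R) : Prop :=
  exists2 C, 0 <= C &
    forall e, `|e| <= 1 -> `|g e - g 0 - a * e| <= C * e ^+ 2.

Lemma quad_expandD (R : realType) (f g : R -> R) a b :
  quad_expand f a -> quad_expand g b -> quad_expand (fun e => f e + g e) (a + b).
Proof.
move=> [C C0 fC] [C' C'0 gC]; exists (C + C'); first exact: addr_ge0.
move=> e e1; have -> : f e + g e - (f 0 + g 0) - (a + b) * e =
  (f e - f 0 - a * e) + (g e - g 0 - b * e) by ring.
by rewrite mulrDl (le_trans (ler_normD _ _))// lerD ?fC ?gC.
Qed.

Lemma quad_expand_sum (R : realType) (I : Type) (r : seq I) (f : I -> R -> R) a :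
  (forall i, quad_expand (f i) (a i)) ->
  quad_expand (fun e => \sum_(i <- r) f i e) (\sum_(i <- r) a i).
Proof.
move=> fa; elim: r => [|i r IH].
  by exists 0 => // e _; rewrite !big_nil !subrr !mul0r subr0 normr0.
rewrite big_cons; under eq_fun do rewrite big_cons.
exact: quad_expandD.
Qed.

(** Chain rule. The remainder is that of [smooth_plus] at the increment of [s], which is at most
    ([|a|] + C) * [|e|] because [|e| <= 1], plus that of [s] times lambda * clip, where clip is at
    most 1. *)
Lemma quad_expand_smooth_plus (R : realType) (lambda mu : R) (s : R -> R) a :
  0 < lambda -> 0 < mu -> quad_expand s a ->
  quad_expand (fun e => smooth_plus lambda mu (s e))
    (lambda * clip mu (s 0) * a).
Proof.
move=> l0 mu0 [C C0 sC]; have /andP[c0 c1] := clip_itv mu (s 0).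
exists (lambda / mu * (`|a| + C) ^+ 2 + lambda * C).
  by rewrite addr_ge0 ?mulr_ge0 ?invr_ge0 ?exprn_ge0 ?addr_ge0 ?(ltW l0) ?(ltW mu0).
move=> e e1; have se := sC e e1.
have sq : (s e - s 0) ^+ 2 <= (`|a| + C) ^+ 2 * e ^+ 2.
  rewrite -exprMn -(real_normK (num_real (s e - s 0))).
  rewrite -[leRHS](real_normK (num_real _)) ler_pXn2r ?nnegrE //.
  rewrite normrM (@ger0_norm _ (`|a| + C)) ?addr_ge0// mulrDl.
  have -> : s e - s 0 = a * e + (s e - s 0 - a * e) by ring.
  rewrite (le_trans (ler_normD _ _))// normrM lerD2l (le_trans se)//.
  rewrite ler_wpM2l // -real_normK ?num_real // expr2.
  by rewrite ler_piMr.
have -> : smooth_plus lambda mu (s e) - smooth_plus lambda mu (s 0)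
    - lambda * clip mu (s 0) * a * e =
  (smooth_plus lambda mu (s e) - smooth_plus lambda mu (s 0)
    - lambda * clip mu (s 0) * (s e - s 0))
  + lambda * clip mu (s 0) * (s e - s 0 - a * e) by ring.
rewrite (le_trans (ler_normD _ _))// mulrDl lerD//.
  rewrite (le_trans (smooth_plus_taylor (s 0) (s e) l0 mu0))//.
  by rewrite -[leRHS]mulrA ler_wpM2l // divr_ge0 ?ltW.
rewrite normrM (@ger0_norm _ (lambda * _)) ?mulr_ge0 ?(ltW l0)//.
rewrite -!mulrA ler_pM2l // (le_trans (ler_wpM2l c0 se))//.
by rewrite ler_piMl // mulr_ge0 ?sqr_ge0.
Qed.

Lemma derive_quad_expand (R : realType) n (g : 'cV[R]_n -> R) x v a :
  quad_expand (fun e => g (e *: v + x)) a -> 'D_v g x = a.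
Proof.
move=> [C C0]; rewrite scale0r add0r => gC.
apply: cvg_lim => //; apply/cvgrPdist_le => eps eps0.
(* C may be 0, so the radius of the neighbourhood is taken with C + 1 as divisor. *)
have C1 : 0 < C + 1 by rewrite ltr_wpDl.
near=> e.
have e0 : e != 0 by near: e; exact: nbhs_dnbhs_neq.
have e1 : `|e| <= 1.
  near: e; apply: dnbhs0_le; exact: ltr01.
have ee : `|e| <= eps / (C + 1).
  near: e; apply: dnbhs0_le; exact: divr_gt0.
have := gC e e1; rewrite /= /shift /= => H.
have -> : a - e^-1 *: (g (e *: v + x) - g x) =
  - (e^-1 * (g (e *: v + x) - g x - a * e)).
  by rewrite /GRing.scale /=; field.
rewrite normrN normrM normfV ler_pdivrMl ?normr_gt0//.
rewrite (le_trans H)// -real_normK ?num_real// expr2 mulrCA ler_pM2l ?normr_gt0//.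
rewrite ler_pdivlMr // in ee; apply: le_trans ee.
by rewrite mulrC ler_wpM2l // lerDl.
Unshelve. all: by end_near. Qed.

Definition ball_viol (R : realType) n m (A : 'M[R]_(m, n)) (b : 'cV[R]_m)
    (sigma : R) (x : 'cV[R]_n) : R :=
  enorm (A *m x - b) ^+ 2 - sigma ^+ 2.

(** Since lambda * clip is the derivative of [smooth_plus], these are the estimates of the Lagrange
    multipliers produced by the penalty. *)
Definition mult_ineq (R : realType) n l (B : 'M[R]_(l, n)) (h : 'cV[R]_l)
    (lambda mu : R) (x : 'cV[R]_n) : 'cV[R]_l :=
  \col_i (lambda * clip mu ((B *m x - h) i 0)).

Definition mult_ball (R : realType) n m (A : 'M[R]_(m, n)) (b : 'cV[R]_m)
    (sigma lambda mu : R) (x : 'cV[R]_n) : R :=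
  lambda * clip mu (ball_viol A b sigma x).

(** Along a line the ball violation is a quadratic polynomial and each row violation is affine, so
    the chain rule applies to every term. The factor 2 comes from the squared residual. *)
Lemma gradient_penalty (R : realType) n m l (A : 'M[R]_(m, n)) (b : 'cV[R]_m)
    (sigma : R) (B : 'M[R]_(l, n)) (h : 'cV[R]_l) (lambda mu : R) x :
  0 < lambda -> 0 < mu ->
  gradient (penalty A b sigma B h lambda mu) x =
    (2 * mult_ball A b sigma lambda mu x) *: (A^T *m (A *m x - b))
    + B^T *m mult_ineq B h lambda mu x.
Proof.
move=> l0 mu0; apply/colP => j; rewrite mxE -[RHS]dotv_delta.
move: (delta_mx j 0) => v; apply: derive_quad_expand.
rewrite dotvDl dotvZl !dotv_adj.
apply: quad_expandD.
  have -> : 2 * mult_ball A b sigma lambda mu x * dotv (A *m x - b) (A *m v) =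
    lambda * clip mu (enorm (A *m (0 *: v + x) - b) ^+ 2 - sigma ^+ 2)
      * (2 * dotv (A *m x - b) (A *m v)).
    by rewrite scale0r add0r /mult_ball /ball_viol; ring.
  apply: (quad_expand_smooth_plus (s := fun e =>
    enorm (A *m (e *: v + x) - b) ^+ 2 - sigma ^+ 2)) => //.
  exists (dotv (A *m v) (A *m v)); first exact: dotv_ge0.
  move=> e _; rewrite scale0r add0r !enorm_sqr.
  have -> : A *m (e *: v + x) - b = e *: (A *m v) + (A *m x - b).
    by rewrite mulmxDr -scalemxAr addrA.
  move: (A *m x - b) (A *m v) => w u.
  rewrite dotvDl !dotvDr !dotvZl !dotvZr (dotvC w u).
  set X := (X in `|X|); have -> : X = dotv u u * e ^+ 2 by rewrite /X; ring.
  by rewrite ger0_norm // mulr_ge0 ?dotv_ge0 ?sqr_ge0.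
rewrite {1}/dotv; apply: quad_expand_sum => i.
rewrite mxE.
have -> : B *m x - h = B *m (0 *: v + x) - h by rewrite scale0r add0r.
apply: (quad_expand_smooth_plus (s := fun e => (B *m (e *: v + x) - h) i 0)) => //.
exists 0 => // e _; rewrite scale0r add0r mul0r mulmxDr -scalemxAr !mxE.
set X := (X in `|X|); have -> : X = 0 by rewrite /X; ring.
by rewrite normr0.
Qed.

(** * Descent property of the inner method *)

Lemma npg_iterate_le (R : realType) n (f : 'cV[R]_n -> R) (P : 'cV[R]_n -> \bar R)
    (y0 z : 'cV[R]_n) :
  npg_iterate f P y0 z -> ((f z)%:E + P z <= (f y0)%:E + P y0)%E.
Proof.
move=> [Lmin [Lmax [tau [c [M [y [J [[_ _ c0] [y0E step ->]]]]]]]]].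
rewrite -y0E.
suff le_y0 : forall j, (j <= J)%N ->
    ((f (y j))%:E + P (y j) <= (f (y 0%N))%:E + P (y 0%N))%E by exact: le_y0.
(* Strong induction is needed: the nonmonotone test compares with a maximum over several earlier
   iterates, each already below the initial value. *)
elim/ltn_ind => -[_ _|j IH jJ]; first exact: lexx.
have [L0 [r [u [_ _ _ acc ->]]]] := step j jJ.
apply: le_trans acc _.
have max_le : (\big[maxe/-oo]_((j - M)%N <= i < j.+1) ((f (y i))%:E + P (y i))
    <= (f (y 0%N))%:E + P (y 0%N))%E.
  rewrite big_nat.
  apply: (big_ind (fun w => w <= (f (y 0%N))%:E + P (y 0%N))%E)
    => [|a b ha hb|i /andP[_ ij]].
  - exact: leNye.
  - by rewrite ge_max ha hb.
  - exact: (IH _ ij (ltnW (leq_trans ij jJ))).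
apply: (le_trans (leeD2r _ max_le)).
apply: geeDl; rewrite oppe_le0 lee_fin.
by rewrite mulr_ge0 ?sqr_ge0 // divr_ge0 // ltW.
Qed.

(** * The extended objective and the geometric parameter sequences *)

Lemma Phi_S1_in (R : realType) n p (Phi : 'cV[R]_n -> R) (D : 'M[R]_(p, n)) d x :
  S1 D d x -> Phi_S1 Phi D d x = (Phi x)%:E.
Proof. by move=> Sx; rewrite /Phi_S1 /indicator mem_set // adde0. Qed.

Lemma Phi_S1_notin (R : realType) n p (Phi : 'cV[R]_n -> R) (D : 'M[R]_(p, n)) d x :
  ~ S1 D d x -> Phi_S1 Phi D d x = +oo%E.
Proof. by move=> Sx; rewrite /Phi_S1 /indicator memNset // addey. Qed.

Lemma Phi_S1_fin (R : realType) n p (Phi : 'cV[R]_n -> R) (D : 'M[R]_(p, n)) d x :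
  Phi_S1 Phi D d x \is a fin_num -> S1 D d x.
Proof. by apply: contraPP => /(@Phi_S1_notin _ _ _ Phi) ->. Qed.

Lemma near_infty_mono (phi : nat -> nat) (P : set nat) :
  increasing_seq phi -> (\forall k \near \oo, P k) ->
  \forall k \near \oo, P (phi k).
Proof.
move=> incr [N _ NP]; exists N => // k /= Nk; apply: NP => /=.
(* It remains to see k <= phi k; [increasing_seq] is an equivalence of orders, so phi is strictly
   increasing. *)
apply: leq_trans Nk _; elim: k => // k IH; apply: leq_ltn_trans IH _.
by rewrite ltnNge; have := incr k.+1 k; rewrite !leEnat ltnn => ->.
Qed.

Lemma geometric_seq (R : realType) (u : nat -> R) (q : R) :
  (forall k, u k.+1 = q * u k) -> forall k, u k = geometric (u 0%N) q k.
Proof.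
move=> uS; elim=> [|k IH]; rewrite /geometric /= ?expr0 ?mulr1//.
by rewrite uS IH exprS /=; ring.
Qed.

Lemma geometric_seq_gt0 (R : realType) (u : nat -> R) (q : R) : 0 < u 0%N -> 0 < q ->
  (forall k, u k.+1 = q * u k) -> forall k, 0 < u k.
Proof.
by move=> u0 q0 uS k; rewrite (geometric_seq uS) mulr_gt0 // exprn_gt0.
Qed.

Lemma geometric_seq_cvg0 (R : realType) (u : nat -> R) (q : R) : 0 < q < 1 ->
  (forall k, u k.+1 = q * u k) -> u k @[k --> \oo] --> 0.
Proof.
move=> /andP[q0 q1] uS; under eq_fun do rewrite (geometric_seq uS).
by apply: cvg_geometric; rewrite gtr0_norm.
Qed.

Lemma geometric_seqV_cvg0 (R : realType) (u : nat -> R) (q : R) : 1 < q ->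
  (forall k, u k.+1 = q * u k) -> (u k)^-1 @[k --> \oo] --> 0.
Proof.
move=> q1 uS; have q0 : 0 < q := lt_trans ltr01 q1.
apply: (geometric_seq_cvg0 (q := q^-1)).
  by rewrite invr_gt0 q0 invf_lt1.
by move=> k; rewrite uS invfM.
Qed.

(** * Bounds on the iterates and feasibility of their limits *)

Section Penalty.
Variables (R : realType) (n m l p : nat).
Variables (Phi : 'cV[R]_n -> R).
Variables (A : 'M[R]_(m, n)) (b : 'cV[R]_m) (sigma : R).
Variables (B : 'M[R]_(l, n)) (h : 'cV[R]_l).
Variables (D : 'M[R]_(p, n)) (d : 'cV[R]_p).

Lemma ball_viol_le0 x : 0 <= sigma ->
  (ball_viol A b sigma x <= 0) = (enorm (A *m x - b) <= sigma).
Proof. by move=> s0; rewrite subr_le0 ler_pXn2r ?nnegrE ?enorm_ge0. Qed.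

Lemma penalty_feasible lambda mu x : 0 <= sigma -> 0 < mu ->
  feasible A b sigma B h D d x -> penalty A b sigma B h lambda mu x = 0.
Proof.
move=> s0 mu0 [_ [sx Bx]]; rewrite /penalty smooth_plus_le0 ?ball_viol_le0 //.
rewrite add0r big1 // => i _; rewrite smooth_plus_le0 // !mxE subr_le0.
by have := Bx i; rewrite !mxE.
Qed.

Lemma penalty_ge0 lambda mu x : 0 < lambda -> 0 < mu ->
  0 <= penalty A b sigma B h lambda mu x.
Proof.
move=> l0 mu0; rewrite addr_ge0 ?smooth_plus_ge0 ?sumr_ge0 // => i _.
exact: smooth_plus_ge0.
Qed.

Lemma viol_le_smooth_plus (lambda mu s C : R) : 0 < lambda -> 0 < mu ->
  smooth_plus lambda mu s <= C -> s <= lambda^-1 * C + mu.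
Proof.
move=> l0 mu0 sC.
(* The competitor t = 1 gives s <= C / lambda + mu / 2, which is then weakened. *)
have := @smooth_plus_ge R lambda mu s 1 l0 mu0.
rewrite ler01 lexx => /(_ isT) /le_trans/(_ sC).
by rewrite -ler_pdivlMl // expr1n !mulr1; lra.
Qed.

Lemma viol_le_penalty lambda mu x C : 0 < lambda -> 0 < mu ->
  penalty A b sigma B h lambda mu x <= C ->
  ball_viol A b sigma x <= lambda^-1 * C + mu /\
  forall i, (B *m x - h) i 0 <= lambda^-1 * C + mu.
Proof.
move=> l0 mu0 pC; have sp0 s := @smooth_plus_ge0 R lambda mu s l0 mu0.
split=> [|i]; apply: viol_le_smooth_plus => //; apply: le_trans pC.
  by rewrite lerDl sumr_ge0.
by rewrite /penalty (bigD1 i) //= addrCA lerDl addr_ge0 ?sumr_ge0.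
Qed.

Lemma cvg_ball_viol I (F : set_system I) {FF : Filter F} (z : I -> 'cV[R]_n) x :
  z k @[k --> F] --> x ->
  ball_viol A b sigma (z k) @[k --> F] --> ball_viol A b sigma x.
Proof.
move=> zx; apply: cvgB; last exact: cvg_cst.
rewrite enorm_sqr; under eq_fun do rewrite /ball_viol enorm_sqr.
by apply: cvg_dotv; (apply: cvgB; [exact: cvg_mulmx|exact: cvg_cst]).
Qed.

Lemma cvg_ineq_viol I (F : set_system I) {FF : Filter F} (z : I -> 'cV[R]_n) x i :
  z k @[k --> F] --> x -> (B *m (z k) - h) i 0 @[k --> F] --> (B *m x - h) i 0.
Proof.
move=> zx; apply: cvg_coord.
by apply: cvgB; [exact: cvg_mulmx|exact: cvg_cst].
Qed.

(** The filter is arbitrary so that the result serves both accumulation points and convergent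
    subsequences. *)
Lemma feasible_limit I (F : set_system I) {FF : ProperFilter F}
    (z : I -> 'cV[R]_n) x :
  0 <= sigma -> z k @[k --> F] --> x ->
  (\forall k \near F, S1 D d (z k)) ->
  (forall e, 0 < e -> \forall k \near F,
     ball_viol A b sigma (z k) <= e /\ forall i, (B *m (z k) - h) i 0 <= e) ->
  feasible A b sigma B h D d x.
Proof.
move=> s0 zx zS viol; split.
  move=> i.
  have Dz : (D *m z k) i 0 @[k --> F] --> (D *m x) i 0.
    by apply: cvg_coord; exact: cvg_mulmx.
  apply: (cvgr_to_le Dz).
  by apply: filterS zS => k; apply.
split.
  rewrite -ball_viol_le0 //; apply/ler_addgt0Pl => e e0; rewrite addr0.
  apply: (cvgr_to_le (cvg_ball_viol zx)).
  by apply: filterS (viol e e0) => k [].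
move=> i; suff : (B *m x - h) i 0 <= 0 by rewrite !mxE subr_le0.
apply/ler_addgt0Pl => e e0; rewrite addr0.
apply: (cvgr_to_le (cvg_ineq_viol (i := i) zx)).
by apply: filterS (viol e e0) => k [].
Qed.

Section Iterates.
Hypothesis Phi_ge0 : forall x, 0 <= Phi x.
Hypothesis sigma_ge0 : 0 <= sigma.
Variables (x : nat -> 'cV[R]_n) (xfeas xinit : 'cV[R]_n).
Variables (lambda mu : nat -> R).
Hypothesis feas : feasible A b sigma B h D d xfeas.
Hypothesis init : S1 D d xinit.
Hypothesis lambda_gt0 : forall k, 0 < lambda k.
Hypothesis mu_gt0 : forall k, 0 < mu k.
Hypothesis lambdaV_cvg0 : (lambda k)^-1 @[k --> \oo] --> 0.
Hypothesis mu_cvg0 : mu k @[k --> \oo] --> 0.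
Hypothesis x_npg : forall k,
  npg_iterate (penalty A b sigma B h (lambda k) (mu k)) (Phi_S1 Phi D d)
    (penalty_start Phi A b sigma B h (lambda k) (mu k) xfeas
       (if k is k'.+1 then x k' else xinit)) (x k).

(** The reset to [xfeas] keeps the starting value below that of [xfeas], which is Phi xfeas because
    the penalty vanishes there; the inner method preserves this bound. *)
Lemma iterate_bound k : S1 D d (x k) /\
  penalized Phi A b sigma B h (lambda k) (mu k) (x k) <= Phi xfeas.
Proof.
have step z k' : S1 D d z ->
    npg_iterate (penalty A b sigma B h (lambda k') (mu k')) (Phi_S1 Phi D d)
      (penalty_start Phi A b sigma B h (lambda k') (mu k') xfeas z) (x k') ->
    S1 D d (x k') /\
    penalized Phi A b sigma B h (lambda k') (mu k') (x k') <= Phi xfeas.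
  move=> Sz /npg_iterate_le.
  have feasE : penalized Phi A b sigma B h (lambda k') (mu k') xfeas = Phi xfeas.
    by rewrite /penalized penalty_feasible ?add0r ?mu_gt0.
  set z0 := penalty_start _ _ _ _ _ _ _ _ _ _.
  have Sz0 : S1 D d z0 by rewrite /z0 /penalty_start; case: ifP => // _; case: feas.
  have z0le : penalized Phi A b sigma B h (lambda k') (mu k') z0 <= Phi xfeas.
    by rewrite /z0 /penalty_start -feasE; case: ltP.
  rewrite (Phi_S1_in _ Sz0) -EFinD => le.
  (* Outside [S1] the value would be infinite, against the finite bound. *)
  have Sx : S1 D d (x k').
    by apply: contrapT => /(@Phi_S1_notin _ _ _ Phi) E; rewrite E addey in le.
  split=> //; apply: le_trans z0le.
  by rewrite (Phi_S1_in _ Sx) -EFinD lee_fin in le.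
elim: k => [|k [Sx _]]; first exact: step init (x_npg 0).
exact: step Sx (x_npg k.+1).
Qed.

Lemma Phi_iterate_le k : Phi (x k) <= Phi xfeas.
Proof.
have [_] := iterate_bound k; apply: le_trans.
by rewrite lerDr penalty_ge0 ?lambda_gt0 ?mu_gt0.
Qed.

Lemma viol_iterate e : 0 < e -> \forall k \near \oo,
  ball_viol A b sigma (x k) <= e /\ forall i, (B *m (x k) - h) i 0 <= e.
Proof.
move=> e0; have le k : penalty A b sigma B h (lambda k) (mu k) (x k) <= Phi xfeas.
  by have [_] := iterate_bound k; apply: le_trans; rewrite lerDl.
have bd : (lambda k)^-1 * Phi xfeas + mu k @[k --> \oo] --> (0 : R).
  rewrite -[X in _ --> X]addr0 -[X in _ --> X + _](mul0r (Phi xfeas)).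
  by apply: cvgD => //; exact: cvgMl.
have : \forall k \near \oo, (lambda k)^-1 * Phi xfeas + mu k <= e.
  by apply: cvgr_le bd _ e0.
apply: filterS => k ke.
have [b1 b2] := viol_le_penalty (lambda_gt0 k) (mu_gt0 k) (le k).
by split=> [|i]; [exact: le_trans ke|exact: le_trans (b2 i) ke].
Qed.

Lemma cluster_feasible xstar :
  cluster (x k @[k --> \oo]) xstar -> feasible A b sigma B h D d xstar.
Proof.
(* An accumulation point is the limit of a filter on the space itself that refines the image filter,
   hence [z := id]. *)
rewrite cluster_cvgE => -[G GF [Gx xG]].
apply: (feasible_limit (F := G) (z := id)) => //.
- by apply: xG; exists 0%N => // k _ /=; case: (iterate_bound k).
- by move=> e e0; apply: xG; exact: viol_iterate.
Qed.

End Iterates.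
End Penalty.

(** * Limits of scaled subgradients *)

Lemma cvg_to_approx (R : realType) (V : normedModType R) I (F : set_system I)
    {FF : Filter F} (f : I -> V) (a : V) e :
  0 < e -> f k @[k --> F] --> a -> \forall k \near F, `|f k - a| < e.
Proof.
move=> e0 /cvgrPdist_lt/(_ e e0); apply: filterS => k; by rewrite distrC.
Qed.

Lemma cvg_harmonic_bound (R : realType) (V : normedModType R) (u : nat -> V) a :
  (forall j, `|u j - a| <= 2 * j.+1%:R^-1 :> R) -> u j @[j --> \oo] --> a.
Proof.
move=> ua; apply/cvgrPdist_lt => e e0.
have e20 : 0 < e / 2 by rewrite divr_gt0.
have : \forall j \near \oo, `|harmonic j - 0| < e / 2 :> R.
  by apply: cvg_to_approx => //; exact: cvg_harmonic.
apply: filterS => j; rewrite subr0 ger0_norm ?harmonic_ge0 // => je.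
rewrite distrC; apply: le_lt_trans (ua j) _.
by rewrite mulrC -ltr_pdivlMr.
Qed.

Lemma limiting_subdiff_approx (R : realType) n (f : 'cV[R]_n -> \bar R) x v e :
  0 < e -> limiting_subdiff f x v ->
  exists x' v', [/\ `|x' - x| <= e, `|v' - v| <= e & regular_subdiff f x' v'].
Proof.
move=> e0 [_ [xs [vs [[xsx _] vsv reg]]]].
have [k [xk vk]] := filter_ex (filterI (cvg_to_approx e0 xsx)
  (cvg_to_approx e0 vsv)).
by exists (xs k), (vs k); split=> //; exact: ltW.
Qed.

(** Diagonal argument: for each j pick an index within 1 / (j + 1) of the limits along F, then a
    regular subgradient that close to the limiting one; [a k <= 1] keeps the scaled error small. It
    turns a limit along any filter into one along a sequence, as the subdifferentials require. *)
Lemma diagonal_regular_subdiff (R : realType) n (f : 'cV[R]_n -> \bar R)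
    I (F : set_system I) {FF : ProperFilter F}
    (xs vs : I -> 'cV[R]_n) (a : I -> R) (x : 'cV[R]_n) (alpha : R) (w : 'cV[R]_n) :
  (forall k, 0 < a k <= 1) -> (forall k, limiting_subdiff f (xs k) (vs k)) ->
  xs k @[k --> F] --> x -> a k @[k --> F] --> alpha ->
  a k *: vs k @[k --> F] --> w ->
  exists (xs' vs' : nat -> 'cV[R]_n) (a' : nat -> R),
    [/\ xs' j @[j --> \oo] --> x, a' j @[j --> \oo] --> alpha,
        a' j *: vs' j @[j --> \oo] --> w, forall j, 0 < a' j
      & forall j, regular_subdiff f (xs' j) (vs' j)].
Proof.
move=> aI lim xsx aa avw.
have /choice [t tP] (j : nat) : exists t : 'cV[R]_n * 'cV[R]_n * R,
    [/\ `|t.1.1 - x| <= 2 * j.+1%:R^-1, `|t.2 - alpha| <= 2 * j.+1%:R^-1,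
        `|t.2 *: t.1.2 - w| <= 2 * j.+1%:R^-1, 0 < t.2
      & regular_subdiff f t.1.1 t.1.2].
  have e0 : 0 < j.+1%:R^-1 :> R by rewrite invr_gt0 ltr0n.
  move: (j.+1%:R^-1) e0 => e e0.
  have [k [[xk ak] avk]] := filter_ex (filterI (filterI (cvg_to_approx e0 xsx)
    (cvg_to_approx e0 aa)) (cvg_to_approx e0 avw)).
  have [x' [v' [x'k v'k reg]]] := limiting_subdiff_approx e0 (lim k).
  have /andP[ak0 ak1] := aI k.
  exists (x', v', a k); split=> //=.
  - have -> : x' - x = (x' - xs k) + (xs k - x) by rewrite addrA subrK.
    by rewrite (le_trans (ler_normD _ _)) // mulr_natl lerD // ltW.
  - by rewrite (le_trans (ltW ak)) // ler_peMl // ?ler1n // ltW.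
  - have -> : a k *: v' - w = a k *: (v' - vs k) + (a k *: vs k - w).
      by rewrite scalerBr addrA subrK.
    rewrite (le_trans (ler_normD _ _)) // mulr_natl lerD //; last exact: ltW.
    by rewrite normrZ gtr0_norm // (le_trans _ v'k) // ler_piMl.
exists (fun j => (t j).1.1), (fun j => (t j).1.2), (fun j => (t j).2).
by split; try (apply: cvg_harmonic_bound => j); try (move=> j); case: (tP j).
Qed.

Lemma attentive_cvg_Phi_S1 (R : realType) n p (Phi : 'cV[R]_n -> R)
    (D : 'M[R]_(p, n)) d xs x :
  continuous Phi -> S1 D d x -> (forall k, S1 D d (xs k)) ->
  xs k @[k --> \oo] --> x -> attentive_cvg (Phi_S1 Phi D d) xs x.
Proof.
move=> Phi_cont Sx Sxs xsx; split=> //; rewrite (Phi_S1_in _ Sx).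
under eq_fun do rewrite (Phi_S1_in _ (Sxs _)).
apply: cvg_EFin; first by exists 0%N.
exact: (cvg_comp xs Phi xsx (Phi_cont x)).
Qed.

(** The factors a' of the diagonal sequence are the vanishing scalings of a horizon subgradient when
    alpha = 0; otherwise they can be divided out in the limit. *)
Lemma limiting_or_horizon (R : realType) n p (Phi : 'cV[R]_n -> R)
    (D : 'M[R]_(p, n)) d I (F : set_system I) {FF : ProperFilter F}
    (xs vs : I -> 'cV[R]_n) (a : I -> R) (x : 'cV[R]_n) (alpha : R) (w : 'cV[R]_n) :
  continuous Phi -> S1 D d x ->
  (forall k, 0 < a k <= 1) ->
  (forall k, limiting_subdiff (Phi_S1 Phi D d) (xs k) (vs k)) ->
  xs k @[k --> F] --> x -> a k @[k --> F] --> alpha ->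
  a k *: vs k @[k --> F] --> w ->
  if alpha == 0 then horizon_subdiff (Phi_S1 Phi D d) x w
  else limiting_subdiff (Phi_S1 Phi D d) x (alpha^-1 *: w).
Proof.
move=> Phi_cont Sx aI lim xsx aa avw.
have [xs' [vs' [a' [x'x a'a a'v'w a'0 reg]]]] :=
  diagonal_regular_subdiff aI lim xsx aa avw.
have att : attentive_cvg (Phi_S1 Phi D d) xs' x.
  apply: attentive_cvg_Phi_S1 => // k.
  by apply: (@Phi_S1_fin _ _ _ Phi); case: (reg k).
have fin : Phi_S1 Phi D d x \is a fin_num by rewrite Phi_S1_in.
case: eqVneq => [alpha0|alphaN0]; split=> //.
  by exists xs', vs', a'; split=> //; rewrite -alpha0.
exists xs', vs'; split=> //.
have -> : vs' = fun k => (a' k)^-1 *: (a' k *: vs' k).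
  by apply/funext => k; rewrite scalerA mulVf ?scale1r // gt_eqF.
by apply: cvgZ => //; apply: cvgV.
Qed.

Lemma dist0_lt (R : realType) n (C : set 'cV[R]_n) (e : R) :
  (dist0 C < e%:E)%E -> exists2 v, C v & enorm v < e.
Proof.
by move=> /ereal_inf_lt [_ [v Cv <-]]; rewrite lte_fin => ve; exists v.
Qed.

(** * Penalty multipliers and normal vectors *)

Section KKT.
Variables (R : realType) (n m l : nat).
Variables (A : 'M[R]_(m, n)) (b : 'cV[R]_m) (sigma : R).
Variables (B : 'M[R]_(l, n)) (h : 'cV[R]_l).

Lemma mult_ball_ge0 lambda mu x : 0 < lambda ->
  0 <= mult_ball A b sigma lambda mu x.
Proof.
move=> l0; rewrite mulr_ge0 ?(ltW l0) //.
by case/andP: (clip_itv mu (ball_viol A b sigma x)).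
Qed.

Lemma mult_ball_eq0 lambda mu x : 0 < mu -> ball_viol A b sigma x <= 0 ->
  mult_ball A b sigma lambda mu x = 0.
Proof. by move=> mu0 le; rewrite /mult_ball clip_le0 ?mulr0. Qed.

(** Row by row: if the row is active at [xstar], a nonnegative multiplier meets a nonpositive
    increment; if inactive, [x] satisfies it and its multiplier vanishes. *)
Lemma mult_ineq_normal lambda mu x xstar u :
  0 < lambda -> 0 < mu -> lev (B *m u) h -> lev (B *m xstar) h ->
  (forall i, (B *m xstar) i 0 < h i 0 -> (B *m x) i 0 <= h i 0) ->
  dotv (B^T *m mult_ineq B h lambda mu x) (u - xstar) <= 0.
Proof.
move=> l0 mu0 Bu Bx inact; rewrite dotv_adj /dotv; apply: sumr_le0 => i _.
have -> : (B *m (u - xstar)) i 0 = (B *m u) i 0 - (B *m xstar) i 0.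
  by rewrite mulmxBr !mxE.
have -> : mult_ineq B h lambda mu x i 0 =
    lambda * clip mu ((B *m x) i 0 - h i 0) by rewrite !mxE.
have /andP[c0 _] := clip_itv mu ((B *m x) i 0 - h i 0).
have := Bx i; rewrite le_eqVlt => /orP[/eqP ->|/inact Bxi].
  by apply: mulr_ge0_le0; rewrite ?subr_le0 ?mulr_ge0 ?(ltW l0).
by rewrite clip_le0 ?mulr0 ?mul0r // subr_le0.
Qed.

(** Gradient inequality for the convex squared residual; the gap is the squared norm of A (u -
    x). *)
Lemma ball_normal (u x : 'cV[R]_n) :
  2 * dotv (A^T *m (A *m x - b)) (u - x) <=
    enorm (A *m u - b) ^+ 2 - enorm (A *m x - b) ^+ 2.
Proof.
rewrite dotv_adj.
have -> : A *m (u - x) = (A *m u - b) + (-1) *: (A *m x - b).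
  by rewrite mulmxBr scaleN1r opprB addrA subrK.
move: (A *m u - b) (A *m x - b) => r s; rewrite !enorm_sqr.
have := dotv_ge0 (r + (-1) *: s).
rewrite !dotvDl !dotvDr !dotvZl !dotvZr (dotvC s r); lra.
Qed.

End KKT.

Lemma cvg_enorm0 (R : realType) n I (F : set_system I) {FF : Filter F}
    (u : I -> 'cV[R]_n) (e : I -> R) :
  (forall k, enorm (u k) <= e k) -> e k @[k --> F] --> 0 ->
  u k @[k --> F] --> (0 : 'cV[R]_n).
Proof.
move=> ue e0; apply: cvg_mxP => i j; rewrite ord1 mxE.
apply: (squeeze_cvgr (f := fun k => - e k) (h := e)) => //.
  apply: (@filterS _ F _ setT) => [k _|]; last exact: filterT.
  by rewrite -ler_norml; apply: le_trans (ue k); exact: coord_le_enorm.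
by rewrite -oppr0; exact: cvgN.
Qed.

(** * Passage to the limit in the stationarity relation *)

Lemma kkt_of_approx_stationary (R : realType) (n m l p : nat)
    (Phi : 'cV[R]_n -> R)
    (A : 'M[R]_(m, n)) (b : 'cV[R]_m) (sigma : R)
    (B : 'M[R]_(l, n)) (h : 'cV[R]_l)
    (D : 'M[R]_(p, n)) (d : 'cV[R]_p)
    (z vs : nat -> 'cV[R]_n) (lambda mu e : nat -> R) (xstar : 'cV[R]_n) :
  continuous Phi -> 0 <= sigma ->
  (exists x0, feasible A b sigma B h D d x0 /\ enorm (A *m x0 - b) < sigma) ->
  feasible A b sigma B h D d xstar ->
  (forall k, 0 < lambda k) -> (forall k, 0 < mu k) ->
  e k @[k --> \oo] --> 0 ->
  z k @[k --> \oo] --> xstar ->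
  (forall k, limiting_subdiff (Phi_S1 Phi D d) (z k) (vs k)) ->
  (forall k,
     enorm (gradient (penalty A b sigma B h (lambda k) (mu k)) (z k) + vs k)
       <= e k) ->
  constraint_qualification Phi A b sigma B h D d xstar ->
  kkt_point Phi A b sigma B h D d xstar.
Proof.
move=> Phi_cont sigma0 [x0 [[_ S2x0] x0int]] feas lambda0 mu0 e0 zx lim stat CQ.
have [Sx [ballx ineqx]] := feas.
pose t k := 2 * mult_ball A b sigma (lambda k) (mu k) (z k).
pose w k := B^T *m mult_ineq B h (lambda k) (mu k) (z k).
pose a k := (1 + t k + `|w k|)^-1.
have t0 k : 0 <= t k by rewrite mulr_ge0 // mult_ball_ge0.
have den0 k : 0 < 1 + t k + `|w k|.
  by rewrite ltr_wpDr // ltr_wpDr.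
have a0 k : 0 < a k by rewrite invr_gt0.
have sumE k : a k + a k * t k + `|a k *: w k| = 1.
  by rewrite normrZ gtr0_norm // -{1}(mulr1 (a k)) -!mulrDr mulVf // gt_eqF.
have at0 k : 0 <= a k * t k by rewrite mulr_ge0 // ltW.
have a1 k : 0 < a k <= 1.
  by rewrite a0 /= -(sumE k) -addrA lerDl addr_ge0.
have at1 k : `|a k * t k| <= 1.
  by rewrite ger0_norm // -(sumE k) -addrA addrCA lerDl addr_ge0 // ltW.
have aw1 k i : `|(a k *: w k) i 0| <= 1.
  rewrite (le_trans (coord_le_norm _ _ _)) // -(sumE k) lerDr addr_ge0 //.
  exact: ltW.
have [U [UU ooU]] := ultraFilterLemma eventually_filter.
have [alpha aU] : exists alpha : R, a k @[k --> U] --> alpha.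
  apply: (ultra_bounded_cvg (C := 1)) => k.
  by have /andP[? ?] := a1 k; rewrite gtr0_norm.
have [T tU] : exists T : R, a k * t k @[k --> U] --> T.
  exact: (ultra_bounded_cvg (C := 1)).
have [W wU] : exists W : 'cV[R]_n, a k *: w k @[k --> U] --> W.
  exact: (ultra_bounded_cvg_cV (C := 1)).
have zU : z k @[k --> U] --> xstar by move=> N /zx; exact: ooU.
have eU : e k @[k --> U] --> 0 by move=> N /e0; exact: ooU.
have limE : alpha + T + `|W| = 1.
  have : a k + a k * t k + `|a k *: w k| @[k --> U] --> alpha + T + `|W|.
    by apply: cvgD; [exact: cvgD|exact: cvg_norm].
  under eq_fun do rewrite sumE.
  by move=> lim1; apply: (cvg_unique _ lim1) => //; exact: cvg_cst.
have alpha0 : 0 <= alpha.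
  apply: (cvgr_to_ge aU); apply: (@filterS _ U _ setT) => [k _|]; first exact: ltW.
  exact: filterT.
have T0 : 0 <= T.
  apply: (cvgr_to_ge tU); apply: (@filterS _ U _ setT) => [k _|] //.
  exact: filterT.
(* Rows inactive at [xstar] are satisfied by [z k] along U, so the scaled [w k] are eventually
   normal at [xstar]. *)
have W_normal u : lev (B *m u) h -> dotv W (u - xstar) <= 0.
  move=> Bu.
  have dU : dotv (a k *: w k) (u - xstar) @[k --> U] --> dotv W (u - xstar).
    by apply: cvg_dotv => //; exact: cvg_cst.
  apply: (cvgr_to_le dU).
  have : \forall k \near U, forall i,
      (B *m xstar) i 0 < h i 0 -> (B *m z k) i 0 <= h i 0.
    apply: filter_forall => i; case: (ltP ((B *m xstar) i 0) (h i 0)) => lt.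
      have BzU : (B *m z k) i 0 @[k --> U] --> (B *m xstar) i 0.
        by apply: cvg_coord; exact: cvg_mulmx.
      have le : \forall k \near U, (B *m z k) i 0 <= h i 0.
        exact: cvgr_le BzU _ lt.
      by apply: filterS le.
    by apply: (@filterS _ U _ setT) => [k _|] //; exact: filterT.
  apply: filterS => k inact; rewrite dotvZl pmulr_rle0 //.
  exact: mult_ineq_normal.
(* Complementary slackness: if the ball constraint is inactive at [xstar], its multiplier vanishes
   along U. *)
have T_compl : T * (enorm (A *m xstar - b) - sigma) = 0.
  move: ballx; rewrite le_eqVlt => /orP[/eqP ->|lt]; first by rewrite subrr mulr0.
  have lt2 : enorm (A *m xstar - b) ^+ 2 < sigma ^+ 2.
    by rewrite ltr_pXn2r ?nnegrE ?enorm_ge0.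
  have sU : ball_viol A b sigma (z k) @[k --> U] --> ball_viol A b sigma xstar.
    exact: cvg_ball_viol.
  suff -> : T = 0 by rewrite mul0r.
  apply/eqP; rewrite eq_le T0 andbT; apply: (cvgr_to_le tU).
  have lt0 : ball_viol A b sigma xstar < 0 by rewrite subr_lt0.
  have near_le0 : \forall k \near U, ball_viol A b sigma (z k) <= 0.
    exact: cvgr_le sU _ lt0.
  by apply: filterS near_le0 => k le0; rewrite /t mult_ball_eq0 ?mulr0.
pose g := T *: (A^T *m (A *m xstar - b)) + W.
(* The slack of [u] is kept on the right: this is sharper than normality of [g] and is what the
   Slater point exploits below. *)
have g_normal u : S2 A b sigma B h u ->
    2 * dotv g (u - xstar) <= T * (enorm (A *m u - b) ^+ 2 - sigma ^+ 2).
  move=> [_ Bu]; rewrite dotvDl dotvZl.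
  have hW := W_normal u Bu.
  have hT := ler_wpM2l T0 (ball_normal A b u xstar).
  have E : T * enorm (A *m xstar - b) ^+ 2 = T * sigma ^+ 2.
    move/eqP: T_compl; rewrite mulf_eq0 => /orP[/eqP ->|]; first by rewrite !mul0r.
    by rewrite subr_eq0 => /eqP ->.
  rewrite mulrBr E -mulrBr in hT; lra.
have gN : normal_cone (S2 A b sigma B h) xstar g.
  move=> u Su; have := g_normal u Su.
  have : T * (enorm (A *m u - b) ^+ 2 - sigma ^+ 2) <= 0.
    by rewrite mulr_ge0_le0 // subr_le0 ler_pXn2r ?nnegrE ?enorm_ge0 //; case: Su.
  lra.
have avU : a k *: vs k @[k --> U] --> - g.
  pose r k := gradient (penalty A b sigma B h (lambda k) (mu k)) (z k) + vs k.
  have rU : r k @[k --> U] --> (0 : 'cV[R]_n) by exact: cvg_enorm0 eU.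
  have -> : (fun k => a k *: vs k) = (fun k => a k *: r k -
      ((a k * t k) *: (A^T *m (A *m z k - b)) + a k *: w k)).
    apply/funext => k; rewrite /r gradient_penalty // -/(t k) -/(w k).
    by rewrite -scalerA -scalerDr -scalerBr (addrC _ (vs k)) addrK.
  rewrite -[X in _ --> X]add0r -(scaler0 _ alpha).
  apply: cvgB; first exact: cvgZ.
  apply: cvgD => //; apply: cvgZ => //; apply: cvg_mulmx.
  by apply: cvgB; [exact: cvg_mulmx|exact: cvg_cst].
have := limiting_or_horizon (FF := @ultra_proper _ _ UU) Phi_cont Sx a1 lim zU aU
  avU.
case: eqVneq => [alphaE|alphaN0] sub; last first.
  split=> //; exists (alpha^-1 *: g).
    move=> u Su; rewrite dotvZl; have := gN u Su.
    by apply: mulr_ge0_le0; rewrite invr_ge0.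
  by exists (alpha^-1 *: - g) => //; rewrite scalerN addrN.
exfalso.
have g0 : g = 0.
  (* Here [- g] is a horizon subgradient and [g] a normal vector, so the qualification applies. *)
  have : [set 0] g by rewrite -CQ; split=> //; exists (- g) => //; rewrite opprK.
  by [].
have TE : T = 0.
  (* With g = 0 this reads 0 <= T * (negative number). *)
  have := g_normal x0 S2x0; rewrite g0 dotvE trmx0 mul0mx mxE mulr0.
  have lt2 : enorm (A *m x0 - b) ^+ 2 - sigma ^+ 2 < 0.
    by rewrite subr_lt0 ltr_pXn2r ?nnegrE ?enorm_ge0.
  by rewrite nmulr_lge0 // => T_le0; apply/eqP; rewrite eq_le T_le0.
have WE : W = 0 by move: g0; rewrite /g TE scale0r add0r.
by move/eqP: limE; rewrite alphaE TE WE normr0 !addr0 eq_sym oner_eq0.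
Qed.

(** * The three claims for the penalty method *)

Theorem theorem4p2 (R : realType) (n m l p : nat)
    (Phi : 'cV[R]_n -> R)
    (A : 'M[R]_(m, n)) (b : 'cV[R]_m) (sigma : R)
    (B : 'M[R]_(l, n)) (h : 'cV[R]_l)
    (D : 'M[R]_(p, n)) (d : 'cV[R]_p)
    (Phi_ge0 : forall x, 0 <= Phi x)
    (Phi_cont : continuous Phi)
    (A_full_row_rank : row_free A)
    (sigma_ge0 : 0 <= sigma)
    (slater : exists x0, feasible A b sigma B h D d x0 /\
                         enorm (A *m x0 - b) < sigma)
    (level : bounded_level_sets Phi D d)
    (x : nat -> 'cV[R]_n)
    (x_gen : penalty_method_sequence Phi A b sigma B h D d x) :
  [/\ bounded_set (range x),
      forall xstar, cluster (x k @[k --> \oo]) xstar ->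
        feasible A b sigma B h D d xstar
    & forall (xstar : 'cV[R]_n) (phi : nat -> nat),
        increasing_seq phi ->
        x (phi k) @[k --> \oo] --> xstar ->
        constraint_qualification Phi A b sigma B h D d xstar ->
        kkt_point Phi A b sigma B h D d xstar].
Proof.
have [xfeas [xinit [lambda [mu [eps [rho [theta H]]]]]]] := x_gen.
have [[feas init rho1 theta1] [[lambda0 mu0 eps0] [[lambdaS muS epsS] gen]]] := H.
have lambda_gt0 := geometric_seq_gt0 lambda0 (lt_trans ltr01 rho1) lambdaS.
have theta_gt0 := (andP theta1).1.
have mu_gt0 := geometric_seq_gt0 mu0 theta_gt0 muS.
have eps_gt0 := geometric_seq_gt0 eps0 theta_gt0 epsS.
have lambdaV_cvg0 := geometric_seqV_cvg0 rho1 lambdaS.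
have mu_cvg0 := geometric_seq_cvg0 theta1 muS.
have npg k := (gen k).1.
have stat k := (gen k).2.
have xS k := (iterate_bound sigma_ge0 feas init mu_gt0 npg k).1.
have xle := Phi_iterate_le sigma_ge0 feas init lambda_gt0 mu_gt0 npg.
have viol := viol_iterate Phi_ge0 sigma_ge0 feas init lambda_gt0 mu_gt0
  lambdaV_cvg0 mu_cvg0 npg.
split.
(* All iterates lie in the single level set at height Phi xfeas. *)
- have [M [Mreal MP]] := level (Phi xfeas).
  by exists M; split=> // r Mr _ [k _ <-]; apply: MP => //; split.
- exact: (cluster_feasible Phi_ge0 sigma_ge0 feas init lambda_gt0 mu_gt0
    lambdaV_cvg0 mu_cvg0 npg).
- move=> xstar phi incr xx CQ.
  have /choice [v vP] k : exists v, limiting_subdiff (Phi_S1 Phi D d) (x k) v /\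
      enorm (gradient (penalty A b sigma B h (lambda k) (mu k)) (x k) + v)
        <= 2 * eps k.
    (* The distance is an infimum; doubling the tolerance makes the bound strict and yields an
       actual subgradient. *)
    have lt : ((eps k)%:E < (2 * eps k)%:E)%E.
      by rewrite lte_fin ltr_pMl ?ltr1n.
    have [_ [v lim <-] /ltW vle] := dist0_lt (le_lt_trans (stat k) lt).
    by exists v.
  apply: (kkt_of_approx_stationary (z := fun k => x (phi k))
    (vs := fun k => v (phi k)) (lambda := fun k => lambda (phi k))
    (mu := fun k => mu (phi k)) (e := fun k => 2 * eps (phi k))) => //.
  + apply: (feasible_limit sigma_ge0 xx).
      by exists 0%N.
    by move=> e e0; exact: near_infty_mono incr (viol e e0).
  + have e0 : 2 * eps k @[k --> \oo] --> 0.
      rewrite -[X in _ --> X](mulr0 2); apply: cvgMr.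
      exact: geometric_seq_cvg0 epsS.
    move=> N /e0; exact: near_infty_mono.
  + by move=> k; case: (vP (phi k)).
  + by move=> k; case: (vP (phi k)).
Qed.
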